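(* Let $(H;\langle\cdot,\cdot\rangle)$ be an infinite dimensional Hilbert space over the real or complex number field $\mathbb{K}$ and $(e_i)_{i\in\mathbb{N}}$ an orthonormal family in $H$. Suppose that $(\Gamma_i)_{i\in\mathbb{N}},(\gamma_i)_{i\in\mathbb{N}},(\phi_i)_{i\in\mathbb{N}},(\Phi_i)_{i\in\mathbb{N}}\in\ell^2(\mathbb{K})$ are such that $$\sum_{i=1}^\infty\operatorname{Re}(\Gamma_i\overline{\gamma_i})>0,\qquad\sum_{i=1}^\infty\operatorname{Re}(\Phi_i\overline{\phi_i})>0 .$$ If $x,y\in H$ are such that either $$\left\|x-\sum_{i=1}^\infty\frac{\Gamma_i+\gamma_i}{2}e_i\right\|\le\frac12\left(\sum_{i=1}^\infty|\Gamma_i-\gamma_i|^2\right)^{\frac12}\quad\text{and}\quad\left\|y-\sum_{i=1}^\infty\frac{\Phi_i+\phi_i}{2}e_i\right\|\le\frac12\left(\sum_{i=1}^\infty|\Phi_i-\phi_i|^2\right)^{\frac12}$$ or, equivalently, $$\operatorname{Re}\left\langle\sum_{i=1}^\infty\Gamma_ie_i-x,\;x-\sum_{i=1}^\infty\gamma_ie_i\right\rangle\ge0\quad\text{and}\quad\operatorname{Re}\left\langle\sum_{i=1}^\infty\Phi_ie_i-y,\;y-\sum_{i=1}^\infty\phi_ie_i\right\rangle\ge0$$ holds, then $$\begin{aligned}&\left|\langle x,y\rangle-\sum_{i=1}^\infty\langle x,e_i\rangle\langle e_i,y\rangle\right|\\&\le\frac14\cdot\frac{\left(\sum_{i=1}^\infty|\Gamma_i-\gamma_i|^2\right)^{\frac12}\left(\sum_{i=1}^\infty|\Phi_i-\phi_i|^2\right)^{\frac12}}{\left(\sum_{i=1}^\infty\operatorname{Re}(\Gamma_i\overline{\gamma_i})\right)^{\frac12}\left(\sum_{i=1}^\infty\operatorname{Re}(\Phi_i\overline{\phi_i})\right)^{\frac12}}\left(\sum_{i=1}^\infty|\langle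 x,e_i\rangle|^2\right)^{\frac12}\left(\sum_{i=1}^\infty|\langle y,e_i\rangle|^2\right)^{\frac12}\\&\le\frac14\cdot\frac{\left(\sum_{i=1}^\infty|\Gamma_i-\gamma_i|^2\right)^{\frac12}\left(\sum_{i=1}^\infty|\Phi_i-\phi_i|^2\right)^{\frac12}}{\left[\sum_{i=1}^\infty\operatorname{Re}(\Gamma_i\overline{\gamma_i})\right]^{\frac12}\left[\sum_{i=1}^\infty\operatorname{Re}(\Phi_i\overline{\phi_i})\right]^{\frac12}}\|x\|\,\|y\| .\end{aligned}$$ The constant $\frac14$ is best possible in the first inequality.
   Context: The inner product is linear in its first argument and $\|z\|=\sqrt{\langle z,z\rangle}$. The family $(e_i)_{i\in\mathbb{N}}$ is orthonormal (not assumed complete): $\langle e_i,e_j\rangle=0$ for $i\ne j$ and $\|e_i\|=1$. $\ell^2(\mathbb{K})$ is the space of sequences $(a_i)_{i\in\mathbb{N}}$ in $\mathbb{K}$ with $\sum_{i=1}^\infty|a_i|^2<\infty$; for $(a_i)\in\ell^2(\mathbb{K})$ the series $\sum_{i=1}^\infty a_ie_i$ converges in $H$. A constant is called best possible if no smaller constant makes the inequality valid for all $H$, $(e_i)$, sequences and vectors satisfying the hypotheses. *)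

(* Defs.v *)
From HB Require Import structures.
From mathcomp Require Import all_boot all_order all_algebra.
From mathcomp Require Import sesquilinear.
From mathcomp Require Import all_classical all_reals all_analysis.
From mathcomp Require Import complex.
Import Order.TTheory GRing.Theory Num.Theory.
Import numFieldNormedType.Exports.

Set Implicit Arguments.
Unset Strict Implicit.
Unset Printing Implicit Defensive.

Local Open Scope ring_scope.
Local Open Scope classical_set_scope.

Inductive scalar_kind := RealScalars | ComplexScalars.

Definition scalar_field (R : realType) (k : scalar_kind) : numFieldType :=
  match k with RealScalars => R | ComplexScalars => R[i] end.

Definition sconj (R : realType) (k : scalar_kind) :
    scalar_field R k -> scalar_field R k :=
  match k with RealScalars => fun a => a | ComplexScalars => @conjc R end.

Definition sre (R : realType) (k : scalar_kind) : scalar_field R k -> R :=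
  match k with RealScalars => fun a => a | ComplexScalars => @complex.Re R end.

(* MathComp norms over a field K take values in K; as `|v| is a nonnegative
   real element of K, its real part is the usual real-valued norm. *)
Definition rnorm (R : realType) (k : scalar_kind)
  (V : normedZmodType (scalar_field R k)) (v : V) : R := sre `|v|.

(* limn is unspecified on divergent sequences. For square-summable scalars and
   an orthonormal family in a Hilbert space, every series below converges. *)
Section sequences.
Context (R : realType) (k : scalar_kind).
Local Notation K := (scalar_field R k).
Implicit Types a G g : nat -> K.

Definition ell2 a : Prop := cvgn [series rnorm (a i) ^+ 2]_i.

Definition ell2_norm a : R := Num.sqrt (limn [series rnorm (a i) ^+ 2]_i).

Definition sum_re G g : R := limn [series sre (G i * sconj (g i))]_i.

End sequences.

Section hilbert.
Context (R : realType) (k : scalar_kind).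
Local Notation K := (scalar_field R k).

Definition infinite_dim (V : lmodType K) : Prop :=
  ~ exists s : seq V, forall v : V,
      exists c : nat -> K, v = \sum_(0 <= i < size s) c i *: s`_i.

Context (H : completeNormedModType K).

(* The complete normed module H carries the Hilbert norm of dot. The form
   is linear in its first argument and conjugate-linear in its second. *)
Definition hilbert_norm (dot : {dot H for @sconj R k}) : Prop :=
  forall z : H, rnorm z = Num.sqrt (sre (dot z z)).

Context (dot : {dot H for @sconj R k}) (e : nat -> H).
Implicit Types (G g : nat -> K) (x y : H).

Definition orthonormal_family : Prop :=
  (forall i j, i <> j -> dot (e i) (e j) = 0) /\ (forall i, rnorm (e i) = 1).

Definition ball_condition G g x : Prop :=
  rnorm (x - limn [series ((G i + g i) / 2) *: e i]_i)
    <= 2^-1 * ell2_norm (fun i => G i - g i).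

Definition re_condition G g x : Prop :=
  0 <= sre (dot (limn [series G i *: e i]_i - x)
                (x - limn [series g i *: e i]_i)).

Definition bessel_gap x y : R :=
  rnorm (dot x y - limn [series dot x (e i) * dot (e i) y]_i).

End hilbert.

(* Main.v *)
Require Import Defs.
From HB Require Import structures.
From mathcomp Require Import all_boot all_order all_algebra.
From mathcomp Require Import sesquilinear.
From mathcomp Require Import all_classical all_reals all_analysis.
From mathcomp Require Import complex ring lra.
Import Order.TTheory GRing.Theory Num.Theory.
Import numFieldNormedType.Exports.

(** Put [G] and [g] for the sums of the orthonormal expansions with
    coefficients [Gamma] and [gamma], and [P] for the orthogonal projection of
    [x] on the closed span of the family.  Orthonormality turns every series of
    the statement into an inner product in [H]: the sum of
    [Re (Gamma_i * conj gamma_i)] is [S = Re <G, g>], the ell2 norm of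
    [Gamma - gamma] is [|G - g|], and that of the Fourier coefficients of [x] is
    [|P|].  These identities hold because the partial sums satisfy them and the
    inner product is continuous ([riesz_fischer], [cvg_dot_expansion]).

    The two hypotheses on [x] are equivalent because
    [Re <G - x, x - g> = |G - g|^2 / 4 - |x - (G + g) / 2|^2]
    ([polarization_ball]).

    Expanding the same inner product, its nonnegativity says
    [|x|^2 + S <= Re <x, G + g> = Re <P, G + g> <= |P| |G + g|].  As
    [|G + g|^2 = |G - g|^2 + 4 S], the arithmetic-geometric mean inequality
    gives [|x - P| <= |G - g| / (2 sqrt S) * |P|] ([reverse_bessel]).
    The analogous bound holds for [y] and its projection [Q].  The gap
    [<x, y> - sum_i <x, e_i> <e_i, y>] is [<x - P, y - Q>], since a
    residual is orthogonal to the span, so Cauchy-Schwarz bounds it by the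
    product of the two residual norms.  This is the first inequality; the second
    one is Bessel's.

    The first inequality is an equality when only one coefficient is involved
    and [x = y] is the point where a line through the origin is tangent to the
    ball: [G = 4 e_0], [g = e_0], [x = y = 8/5 e_0 + 6/5 f] with [f] a unit
    vector orthogonal to all [e_i] ([quarter_attained]).  Such a configuration
    lives in the Hilbert space of square-summable sequences, constructed here
    over both scalar fields, with [f] the first vector of the standard basis and
    [(e_i)] the remaining ones.
    With [c] in place of 1/4 the inequality reads there
    [(6/5)^2 <= c * (9/4) * (8/5)^2], that is [1/4 <= c]. *)

Set Implicit Arguments.
Unset Strict Implicit.
Unset Printing Implicit Defensive.

Local Open Scope ring_scope.
Local Open Scope classical_set_scope.

(** * Scalars *)

(** The real and the complex case are treated at once: only the lemmas of this
    part distinguish them, and everything afterwards goes through the real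
    embedding, [sre], [sconj] and [imag_unit]. *)
Definition of_real (R : realType) (k : scalar_kind) : R -> scalar_field R k :=
  match k with RealScalars => fun r => r | ComplexScalars => real_complex R end.

(** The value 0 in the real case makes the decomposition of a scalar into two
    real coordinates uniform in the scalar field. *)
Definition imag_unit (R : realType) (k : scalar_kind) : scalar_field R k :=
  match k with RealScalars => 0 | ComplexScalars => Complex 0 1 end.

Section scalars.
Context (R : realType) (k : scalar_kind).
Local Notation K := (scalar_field R k).
Local Notation of_real := (@of_real R k).

Fact of_real_zmod : zmod_morphism of_real.
Proof. by rewrite /of_real; case: k => // x y; rewrite raddfB. Qed.
HB.instance Definition _ := GRing.isZmodMorphism.Build R K of_real of_real_zmod.

Fact of_real_monoid : monoid_morphism of_real.
Proof.
rewrite /of_real; case: k => //; split; first exact: rmorph1.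
by move=> x y; rewrite rmorphM.
Qed.
HB.instance Definition _ :=
  GRing.isMonoidMorphism.Build R K of_real of_real_monoid.

Fact sconj_zmod : zmod_morphism (@sconj R k).
Proof. by rewrite /sconj; case: k => // x y; rewrite raddfB. Qed.
HB.instance Definition _ :=
  GRing.isZmodMorphism.Build K K (@sconj R k) sconj_zmod.

Fact sconj_monoid : monoid_morphism (@sconj R k).
Proof.
rewrite /sconj; case: k => //; split; first exact: rmorph1.
by move=> x y; rewrite rmorphM.
Qed.
HB.instance Definition _ :=
  GRing.isMonoidMorphism.Build K K (@sconj R k) sconj_monoid.

Fact sre_zmod : zmod_morphism (@sre R k).
Proof. by rewrite /sre; case: k => // -[a b] [c d]. Qed.
HB.instance Definition _ := GRing.isZmodMorphism.Build K R (@sre R k) sre_zmod.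

Lemma of_realK : cancel of_real (@sre R k).
Proof. by rewrite /of_real /sre; case: k. Qed.

Lemma sre_of_realM (r : R) (z : K) : sre (of_real r * z) = r * sre z.
Proof.
by rewrite /of_real /sre; case: k z => // -[a b] /=; rewrite mul0r subr0.
Qed.

Lemma sre_conj (z : K) : sre (sconj z) = sre z.
Proof. by rewrite /sconj /sre; case: k z => // -[]. Qed.

Lemma sconjK : involutive (@sconj R k).
Proof. by rewrite /sconj; case: k => //; exact: conjcK. Qed.

Lemma sconj_of_real (r : R) : sconj (of_real r) = of_real r.
Proof. by rewrite /sconj /of_real; case: k => //; exact: conjc_real. Qed.

Lemma ler_of_real (r s : R) : (of_real r <= of_real s) = (r <= s).
Proof. by rewrite /of_real; case: k => //; rewrite lecR. Qed.

Lemma ltr_of_real (r s : R) : (of_real r < of_real s) = (r < s).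
Proof. by rewrite /of_real; case: k => //; rewrite ltcR. Qed.

Lemma ge0_of_real (z : K) : 0 <= z -> z = of_real (sre z).
Proof.
rewrite /of_real /sre; case: k z => //= z z0.
by rewrite RRe_real// ger0_real.
Qed.

Lemma gt0_sre (z : K) : 0 < z -> 0 < sre z.
Proof. by move=> z0; rewrite -ltr_of_real -ge0_of_real ?ltW// rmorph0. Qed.

Lemma mulr_sconj (z : K) : z * sconj z = of_real (rnorm z ^+ 2).
Proof.
rewrite rmorphXn /= /rnorm -ge0_of_real//.
rewrite /sconj; case: k z => /= z; first by rewrite real_normK ?num_real.
by rewrite -sqr_normc.
Qed.

Lemma sre_decomp (z : K) :
  z = of_real (sre z) +
      of_real (sre (sconj (imag_unit R k) * z)) * imag_unit R k.
Proof.
rewrite /of_real /sre /sconj /imag_unit; case: k z => /= [z|[a b]].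
  by rewrite mulr0 addr0.
by apply/eqP; rewrite eq_complex /=; apply/andP; split; apply/eqP; ring.
Qed.

Lemma normr_of_real (r : R) : `|of_real r| = of_real `|r|.
Proof.
rewrite /of_real; case: k => //=; rewrite normc_def /=.
by rewrite expr0n /= addr0 sqrtr_sqr.
Qed.

Section norm.
Context (V : normedZmodType K).
Implicit Types u v : V.

Lemma normr_rnorm v : `|v| = of_real (rnorm v).
Proof. exact: ge0_of_real. Qed.

Lemma rnorm_ge0 v : 0 <= rnorm v.
Proof. by rewrite -ler_of_real -normr_rnorm rmorph0. Qed.

Lemma rnorm0 : rnorm (0 : V) = 0.
Proof. by rewrite /rnorm normr0 raddf0. Qed.

Lemma rnormN v : rnorm (- v) = rnorm v.
Proof. by rewrite /rnorm normrN. Qed.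

Lemma ler_rnormD u v : rnorm (u + v) <= rnorm u + rnorm v.
Proof. by rewrite -ler_of_real rmorphD /= -!normr_rnorm ler_normD. Qed.

End norm.

Lemma rnormM (a b : K) : rnorm (a * b) = rnorm a * rnorm b.
Proof. by rewrite {1}/rnorm normrM {1}(normr_rnorm a) sre_of_realM. Qed.

Lemma rnorm_of_real (r : R) : rnorm (of_real r) = `|r|.
Proof. by rewrite /rnorm normr_of_real of_realK. Qed.

Lemma rnorm_conj (z : K) : rnorm (sconj z) = rnorm z.
Proof.
apply/eqP; rewrite -(eqrXn2 (n := 2))// ?rnorm_ge0//; apply/eqP.
by apply: (can_inj of_realK); rewrite -!mulr_sconj sconjK mulrC.
Qed.

Lemma ler_sre (z : K) : `|sre z| <= rnorm z.
Proof.
rewrite /rnorm /sre; case: k z => //= z.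
by have := normc_ge_Re z; rewrite lecE => /andP[_] /=.
Qed.

(** The topology of a normed module is defined by scalar-valued radii; this
    brings every limit back to a limit of reals. *)
Lemma cvg_rnormP (V : normedModType K) T (F : set_system T) (FF : Filter F)
    (f : T -> V) (l : V) :
  f @ F --> l <-> (fun t => rnorm (l - f t)) @ F --> (0 : R).
Proof.
split=> [/cvgrPdist_lt fl|/cvgrPdist_lt fl].
  apply/cvgrPdist_lt => e e0; have := fl (of_real e).
  rewrite -{1}(rmorph0 of_real) ltr_of_real => /(_ e0); apply: filterS => t.
  by rewrite normr_rnorm ltr_of_real sub0r normrN ger0_norm// rnorm_ge0.
apply/cvgrPdist_lt => e e0; have := fl (sre e) (gt0_sre e0).
apply: filterS => t.
rewrite sub0r normrN ger0_norm ?rnorm_ge0// -ltr_of_real -normr_rnorm.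
by rewrite -ge0_of_real ?ltW.
Qed.

End scalars.

(** * Inner products *)

Section inner_product.
Context (R : realType) (k : scalar_kind).
Local Notation K := (scalar_field R k).
Context (U : lmodType K) (dot : {dot U for @sconj R k}).
Implicit Types x y z : U.

Definition sqn x : R := sre (dot x x).
Definition dotR x y : R := sre (dot x y).

Lemma dot_conj x y : dot y x = sconj (dot x y).
Proof. by rewrite (hermitian_subproof (s := dot) y x) expr0 mul1r. Qed.

Lemma dotDl x y z : dot (x + y) z = dot x z + dot y z.
Proof. exact: linearDl. Qed.
Lemma dotDr x y z : dot z (x + y) = dot z x + dot z y.
Proof. by rewrite linearD. Qed.
Lemma dotNl x z : dot (- x) z = - dot x z.
Proof. exact: linearNl. Qed.
Lemma dotNr x z : dot z (- x) = - dot z x.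
Proof. by rewrite linearN. Qed.
Lemma dotBl x y z : dot (x - y) z = dot x z - dot y z.
Proof. by rewrite dotDl dotNl. Qed.
Lemma dotBr x y z : dot z (x - y) = dot z x - dot z y.
Proof. by rewrite dotDr dotNr. Qed.
Lemma dotZl a x z : dot (a *: x) z = a * dot x z.
Proof. exact: linearZl_LR. Qed.
Lemma dotZr a x z : dot z (a *: x) = sconj a * dot z x.
Proof. by rewrite linearZ. Qed.
Lemma dot0l z : dot 0 z = 0.
Proof. by rewrite -(scale0r 0) dotZl mul0r. Qed.
Lemma dot0r z : dot z 0 = 0.
Proof. by rewrite -(scale0r 0) dotZr rmorph0 mul0r. Qed.

Lemma dot_suml I (r : seq I) (f : I -> U) z :
  dot (\sum_(i <- r) f i) z = \sum_(i <- r) dot (f i) z.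
Proof.
by elim/big_ind2 : _ => [|u a v b <- <-|//]; rewrite ?dot0l ?dotDl.
Qed.

Lemma dot_sumr I (r : seq I) (f : I -> U) z :
  dot z (\sum_(i <- r) f i) = \sum_(i <- r) dot z (f i).
Proof.
by elim/big_ind2 : _ => [|u a v b <- <-|//]; rewrite ?dot0r ?dotDr.
Qed.

Lemma dotRDl x y z : dotR (x + y) z = dotR x z + dotR y z.
Proof. by rewrite /dotR dotDl raddfD. Qed.
Lemma dotRNl x z : dotR (- x) z = - dotR x z.
Proof. by rewrite /dotR dotNl raddfN. Qed.
Lemma dotRC x y : dotR x y = dotR y x.
Proof. by rewrite /dotR dot_conj sre_conj. Qed.
Lemma dotRDr x y z : dotR z (x + y) = dotR z x + dotR z y.
Proof. by rewrite !(dotRC z) dotRDl. Qed.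
Lemma dotRNr x z : dotR z (- x) = - dotR z x.
Proof. by rewrite !(dotRC z) dotRNl. Qed.
Definition dotRE := (dotRDl, dotRDr, dotRNl, dotRNr).

Lemma sqn_ge0 x : 0 <= sqn x.
Proof.
have [->|x0] := eqVneq x 0; first by rewrite /sqn dot0l raddf0.
exact/ltW/gt0_sre/neq0_dnorm_gt0.
Qed.

Lemma sqn_eq0 x : sqn x = 0 -> x = 0.
Proof.
have [->//|x0] := eqVneq x 0.
have := gt0_sre (neq0_dnorm_gt0 (s := dot) _ x0).
by rewrite /sqn => /gt_eqF/eqP.
Qed.

Lemma dot_self x : dot x x = of_real k (sqn x).
Proof.
have [->|x0] := eqVneq x 0; first by rewrite /sqn dot0l raddf0 rmorph0.
by apply: ge0_of_real; apply/ltW/neq0_dnorm_gt0.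
Qed.

Lemma sqnZ a x : sqn (a *: x) = rnorm a ^+ 2 * sqn x.
Proof. by rewrite /sqn dotZl dotZr mulrA mulr_sconj sre_of_realM. Qed.

Lemma sqnD x y : sqn (x + y) = sqn x + sqn y + 2 * dotR x y.
Proof. by rewrite /sqn -!/(dotR _ _) !dotRE (dotRC y x); ring. Qed.

Lemma sqnN x : sqn (- x) = sqn x.
Proof. by rewrite /sqn -!/(dotR _ _) !dotRE opprK. Qed.

Lemma sqnB x y : sqn (x - y) = sqn x + sqn y - 2 * dotR x y.
Proof. by rewrite sqnD sqnN dotRNr mulrN. Qed.

(** The squared norm of [|y|^2 x - <x, y> y] is
    [|y|^2 (|x|^2 |y|^2 - |<x, y>|^2)], and it is nonnegative. *)
Lemma sqr_dot_le x y : rnorm (dot x y) ^+ 2 <= sqn x * sqn y.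
Proof.
have [->|y0] := eqVneq y 0.
  by rewrite dot0r rnorm0 expr0n mulr_ge0 ?sqn_ge0.
have sy : 0 < sqn y by apply/gt0_sre/neq0_dnorm_gt0.
have := sqn_ge0 (of_real k (sqn y) *: x - dot x y *: y).
rewrite sqnB !sqnZ rnorm_of_real /dotR dotZl dotZr (mulrC (sconj _)) mulrAC.
rewrite -mulrA.
rewrite [_ * sconj _]mulrC (mulrC (sconj _)) mulr_sconj sre_of_realM of_realK.
rewrite ger0_norm ?(ltW sy)// => h.
rewrite -(ler_pM2l sy) -subr_ge0.
by apply: le_trans h _; rewrite le_eqVlt; apply/orP; left; apply/eqP; ring.
Qed.

Definition hnorm x : R := Num.sqrt (sqn x).

Lemma sqr_hnorm x : hnorm x ^+ 2 = sqn x.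
Proof. by rewrite sqr_sqrtr ?sqn_ge0. Qed.

Lemma Cauchy_Schwarz x y : rnorm (dot x y) <= hnorm x * hnorm y.
Proof.
rewrite -(ler_pXn2r (n := 2))// ?nnegrE ?rnorm_ge0//; last first.
  by rewrite mulr_ge0 ?sqrtr_ge0.
by rewrite exprMn !sqr_hnorm sqr_dot_le.
Qed.

Lemma dotR_le x y : dotR x y <= hnorm x * hnorm y.
Proof.
exact: le_trans (ler_norm _) (le_trans (ler_sre _) (Cauchy_Schwarz _ _)).
Qed.

Lemma ler_hnormD x y : hnorm (x + y) <= hnorm x + hnorm y.
Proof.
rewrite -(ler_pXn2r (n := 2))// ?nnegrE ?sqrtr_ge0//; last first.
  by rewrite addr_ge0 ?sqrtr_ge0.
rewrite sqr_hnorm sqnD sqrrD !sqr_hnorm.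
by have := dotR_le x y; rewrite -mulr_natl; lra.
Qed.

Lemma hnormZ a x : hnorm (a *: x) = rnorm a * hnorm x.
Proof.
by rewrite /hnorm sqnZ sqrtrM ?sqr_ge0// sqrtr_sqr ger0_norm ?rnorm_ge0.
Qed.

Lemma hnorm_eq0 x : hnorm x = 0 -> x = 0.
Proof.
move=> /eqP; rewrite sqrtr_eq0 => x0; apply: sqn_eq0.
by apply/eqP; rewrite eq_le x0 sqn_ge0.
Qed.

End inner_product.

Section reverse_inequality.
Context (R : realType) (k : scalar_kind).
Local Notation K := (scalar_field R k).
Context (U : lmodType K) (dot : {dot U for @sconj R k}).
Implicit Types x G g P : U.

(** The ball having the segment from [g] to [G] as a diameter is the set of the
    [x] from which this segment is seen under a non-acute angle. *)
Lemma polarization_ball G g x :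
  dotR dot (G - x) (x - g) =
  (2^-1 * hnorm dot (G - g)) ^+ 2 - sqn dot (x - 2^-1 *: (G + g)).
Proof.
have -> : 2^-1 = of_real k 2^-1 :> K.
  by rewrite rmorphV ?unitfE ?pnatr_eq0// rmorph_nat.
rewrite exprMn sqr_hnorm !sqnB sqnZ rnorm_of_real ger0_norm// sqnD !dotRE.
rewrite -[dotR dot x x]/(sqn dot x).
have -> : dotR dot x (of_real k 2^-1 *: (G + g)) =
    2^-1 * (dotR dot G x + dotR dot x g).
  rewrite {1}/dotR dotZr sconj_of_real sre_of_realM -/(dotR _ _ _) dotRDr.
  by rewrite (dotRC dot x G).
by field.
Qed.

(** A reverse of Bessel's inequality.  The first two hypotheses are what is
    needed of an orthogonal projection [P] of [x]: the residual is orthogonal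
    to [P] and to [G + g].  With [p = |P|], [q = |G + g|] and [S = Re <G, g>],
    the last hypothesis reads [|x|^2 <= p q - S], and
    [p q - S <= p^2 q^2 / (4 S)]; subtract [p^2] from both sides. *)
Lemma reverse_bessel G g x P :
  dotR dot x P = sqn dot P -> dotR dot x (G + g) = dotR dot P (G + g) ->
  0 < dotR dot G g -> 0 <= dotR dot (G - x) (x - g) ->
  hnorm dot (x - P) <=
    2^-1 * (hnorm dot (G - g) / Num.sqrt (dotR dot G g)) * hnorm dot P.
Proof.
set S := dotR dot G g => xP xGg S0 re.
have S0' := sqrtr_gt0 S; rewrite S0 in S0'.
rewrite -(ler_pXn2r (n := 2))// ?nnegrE ?sqrtr_ge0//; last first.
  by rewrite !mulr_ge0 ?invr_ge0 ?sqrtr_ge0.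
rewrite !exprMn !exprVn.
rewrite (sqr_sqrtr (ltW S0)) !sqr_hnorm sqnB -/(dotR _ _ _) xP.
have GgP : sqn dot x + S <= hnorm dot P * hnorm dot (G + g).
  apply: le_trans (dotR_le dot P (G + g)); rewrite -xGg.
  move: re; rewrite !dotRE -/S (dotRC dot G x) -/(sqn dot x); lra.
have -> : sqn dot (G - g) = hnorm dot (G + g) ^+ 2 - 4 * S.
  by rewrite sqr_hnorm sqnB sqnD -/S; ring.
rewrite -(sqr_hnorm dot x) in GgP *; rewrite -(sqr_hnorm dot P).
set p := hnorm dot P in GgP *; set q := hnorm dot (G + g) in GgP *.
set n := hnorm dot x in GgP *.
rewrite -(ler_pM2l S0).
have -> : S * ((2 ^+ 2)^-1 * ((q ^+ 2 - 4 * S) / S) * p ^+ 2) =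
  ((p * q) ^+ 2 - 4 * S * p ^+ 2) / 4 by field; rewrite gt_eqF.
(* the arithmetic-geometric mean inequality 4 S (p q) <= (p q)^2 + 4 S^2 *)
have := sqr_ge0 (p * q - 2 * S); nra.
Qed.

End reverse_inequality.

(** * Orthonormal expansions *)

Section scalar_limits.
Context (R : realType) (k : scalar_kind).
Local Notation K := (scalar_field R k).
Context T (F : set_system T) {FF : Filter F}.

Lemma cvg_sre (f : T -> K) l :
  f @ F --> l -> (fun t => sre (f t)) @ F --> sre l.
Proof.
move=> /cvg_rnormP fl; apply/cvgrPdist_lt => e e0.
move/cvgrPdist_lt : fl => /(_ _ e0); apply: filterS => t.
rewrite sub0r normrN ger0_norm ?rnorm_ge0//; apply: le_lt_trans.
by rewrite -raddfB; exact: ler_sre.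
Qed.

Lemma cvg_conj (f : T -> K) l :
  f @ F --> l -> (fun t => sconj (f t)) @ F --> sconj l.
Proof.
move=> /cvg_rnormP fl; apply/cvg_rnormP.
by under eq_fun do rewrite -rmorphB rnorm_conj.
Qed.

Lemma cvg_of_real (f : T -> R) l :
  f @ F --> l -> (fun t => of_real k (f t)) @ F --> of_real k l.
Proof.
move=> fl; apply/cvg_rnormP; under eq_fun do rewrite -rmorphB rnorm_of_real.
apply/cvgrPdist_lt => e e0.
move/cvgrPdist_lt : fl => /(_ _ e0); apply: filterS => t.
by rewrite sub0r normrN normr_id.
Qed.
End scalar_limits.

Lemma cvg_ext T U (F : set_system T) (G : set_system U) (f g : T -> U) :
  f =1 g -> f @ F --> G -> g @ F --> G.
Proof. by move=> /funext ->. Qed.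

Section orthonormal_series.
Context (R : realType) (k : scalar_kind).
Local Notation K := (scalar_field R k).
Context (H : completeNormedModType K) (dot : {dot H for @sconj R k}).
Hypothesis Hdot : hilbert_norm dot.
Implicit Types x y : H.

Lemma rnorm_hnorm x : rnorm x = hnorm dot x.
Proof. exact: Hdot. Qed.

Lemma sqr_rnorm x : rnorm x ^+ 2 = sqn dot x.
Proof. by rewrite rnorm_hnorm sqr_hnorm. Qed.

Lemma cvg_dot T (F : set_system T) {FF : Filter F} (f g : T -> H) x y :
  f @ F --> x -> g @ F --> y -> (fun t => dot (f t) (g t)) @ F --> dot x y.
Proof.
move=> /cvg_rnormP fx /cvg_rnormP gy; apply/cvg_rnormP.
apply: (@squeeze_cvgr _ _ _ _ (cst 0)
  (fun t => rnorm (x - f t) * (rnorm (y - g t) + rnorm y)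
            + rnorm x * rnorm (y - g t))).
- apply: nearW => t; rewrite rnorm_ge0 /=.
  have -> : dot x y - dot (f t) (g t) = dot (x - f t) (g t) + dot x (y - g t).
    by rewrite dotBl dotBr; ring.
  apply: le_trans (ler_rnormD _ _) _; apply: lerD.
    apply: le_trans (Cauchy_Schwarz _ _ _) _; rewrite -!rnorm_hnorm.
    apply: ler_wpM2l; first exact: rnorm_ge0.
    rewrite -{1}(subrK y (g t)) -opprB; apply: le_trans (ler_rnormD _ _) _.
    by rewrite rnormN.
  by rewrite !rnorm_hnorm; exact: Cauchy_Schwarz.
- exact: cvg_cst.
- rewrite [X in _ --> X](_ : _ = 0 * (0 + rnorm y) + rnorm x * 0); last first.
    by ring.
  apply: cvgD; apply: cvgM => //; last exact: cvg_cst.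
  by apply: cvgD => //; exact: cvg_cst.
Qed.

Context (e : nat -> H).
Hypothesis oe : orthonormal_family dot e.

Lemma dot_orthonormal i j : dot (e i) (e j) = (i == j)%:R.
Proof.
have [<-|/eqP ij] := eqVneq i j; last by case: oe => ->.
by rewrite dot_self -sqr_rnorm; case: oe => _ ->; rewrite expr1n rmorph1.
Qed.

Lemma dot_sum_left (r : seq nat) (a : nat -> K) j : uniq r ->
  dot (\sum_(i <- r) a i *: e i) (e j) = if j \in r then a j else 0.
Proof.
elim: r => [|i r IH] /=; first by rewrite big_nil dot0l.
move=> /andP[ir /IH {}IH]; rewrite big_cons dotDl dotZl dot_orthonormal IH inE.
have [ij|ij] := eqVneq i j; rewrite ?mulr0 ?mulr1 ?add0r //=.
by rewrite -ij (negbTE ir) addr0.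
Qed.

Lemma dot_sum_sum (r : seq nat) (a b : nat -> K) : uniq r ->
  dot (\sum_(i <- r) a i *: e i) (\sum_(i <- r) b i *: e i) =
  \sum_(i <- r) a i * sconj (b i).
Proof.
elim: r => [|i r IH] /=; first by rewrite !big_nil dot0l.
move=> /andP[ir ur]; rewrite !big_cons !dotDl !dotDr IH//.
rewrite !dotZl !dotZr dot_orthonormal eqxx mulr1 dot_sum_left// (negbTE ir).
by rewrite dot_conj dot_sum_left// (negbTE ir) rmorph0 !mulr0 addr0 add0r.
Qed.

Lemma sqn_sum (r : seq nat) (a : nat -> K) : uniq r ->
  sqn dot (\sum_(i <- r) a i *: e i) = \sum_(i <- r) rnorm (a i) ^+ 2.
Proof.
move=> ur; rewrite /sqn dot_sum_sum// raddf_sum; apply: eq_bigr => i _.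
by rewrite mulr_sconj /= of_realK.
Qed.

Definition expansion (a : nat -> K) : H := limn [series a i *: e i]_i.
Definition expansion_cvg (a : nat -> K) := cvgn [series a i *: e i]_i.

(** A block of the expansion has squared norm the corresponding block of
    [sum_i |a_i|^2], so the expansion is Cauchy, and [H] is complete. *)
Lemma riesz_fischer a : ell2 a -> expansion_cvg a.
Proof.
move=> /cauchy_cvgP/cauchy_seriesP ea; apply/cauchy_cvgP/cauchy_seriesP => d d0.
have d0' := gt0_sre d0.
apply: filterS (ea _ (exprn_gt0 2 d0')) => -[m n] /=.
rewrite ger0_norm ?sumr_ge0// => [|i _]; last exact: sqr_ge0.
rewrite -sqn_sum ?iota_uniq// -sqr_rnorm.
rewrite ltr_pXn2r ?nnegrE ?rnorm_ge0 ?(ltW d0')//.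
by rewrite -(ltr_of_real k) -normr_rnorm -ge0_of_real ?ltW.
Qed.

(** Parseval's identity.  The scalar series converges because its partial sums
    are the inner products of the partial sums of the expansions. *)
Lemma cvg_dot_expansion a b : expansion_cvg a -> expansion_cvg b ->
  [series a i * sconj (b i)]_i @ \oo --> dot (expansion a) (expansion b).
Proof.
move=> ca cb; apply: cvg_ext (cvg_dot ca cb) => n.
by rewrite /series /= dot_sum_sum// iota_uniq.
Qed.

Lemma sum_re_expansion a b : expansion_cvg a -> expansion_cvg b ->
  sum_re a b = dotR dot (expansion a) (expansion b).
Proof.
move=> ca cb; apply/cvg_lim => //.
apply: cvg_ext (cvg_sre (cvg_dot_expansion ca cb)) => n.
by rewrite /series /= raddf_sum.
Qed.

Lemma cvg_sqr_expansion a : expansion_cvg a ->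
  [series rnorm (a i) ^+ 2]_i @ \oo --> sqn dot (expansion a).
Proof.
move=> ca; apply: cvg_ext (cvg_sre (cvg_dot_expansion ca ca)) => n.
rewrite /series /= raddf_sum; apply: eq_bigr => i _.
by rewrite mulr_sconj /= of_realK.
Qed.

Lemma ell2_norm_expansion a :
  expansion_cvg a -> ell2_norm a = rnorm (expansion a).
Proof.
move=> /cvg_sqr_expansion h; rewrite rnorm_hnorm /ell2_norm.
by move/cvg_lim : h => ->.
Qed.

Lemma cvg_expansionB a b : expansion_cvg a -> expansion_cvg b ->
  [series (a i - b i) *: e i]_i @ \oo --> expansion a - expansion b.
Proof.
move=> ca cb; apply: cvg_ext (cvgB ca cb) => n.
rewrite !fctE /series /= -sumrB; apply: eq_bigr => i _.
by rewrite scalerBl.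
Qed.

Lemma cvg_expansion_mid a b : expansion_cvg a -> expansion_cvg b ->
  [series ((a i + b i) / 2) *: e i]_i @ \oo -->
    2^-1 *: (expansion a + expansion b).
Proof.
move=> ca cb; apply: cvg_ext (cvgZr (k := 2^-1 : K) (cvgD ca cb)) => n.
rewrite !fctE /series /= -big_split scaler_sumr; apply: eq_bigr => i _ /=.
by rewrite -scalerDl scalerA mulrC.
Qed.

Lemma cvg_expansion_dotl a y : expansion_cvg a ->
  (fun n => dot ([series a i *: e i]_i n) y) @ \oo --> dot (expansion a) y.
Proof. by move=> ca; apply: cvg_dot ca _; exact: cvg_cst. Qed.

Lemma cvg_expansion_dotr a y : expansion_cvg a ->
  (fun n => dot y ([series a i *: e i]_i n)) @ \oo --> dot y (expansion a).
Proof. by move=> ca; apply: cvg_dot _ ca; exact: cvg_cst. Qed.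

(** The coefficients of the partial sums at [j] are eventually [a j]. *)
Lemma dot_expansion a j : expansion_cvg a -> dot (expansion a) (e j) = a j.
Proof.
move=> ca; have h := cvg_expansion_dotl (y := e j) ca.
apply/esym; rewrite -(cvg_lim _ h)//; apply/esym/cvg_lim => //.
apply: cvg_near_cst; near=> n; rewrite /series /= dot_sum_left ?iota_uniq//.
rewrite mem_index_iota leq0n /=; case: ifP => // /negP[]; near: n.
exact: nbhs_infty_gt.
Unshelve. all: by end_near. Qed.

(** The partial sum [P] of the Fourier series of [x] satisfies
    [Re <x, P> = |P|^2], whence [|P|^2 = |x|^2 - |x - P|^2 <= |x|^2]. *)
Lemma bessel_cvg x : ell2 (fun i => dot x (e i)).
Proof.
apply: nondecreasing_is_cvgn.
  by apply: nondecreasing_series => n _ _; exact: sqr_ge0.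
exists (sqn dot x) => _ [n _ <-]; rewrite /series /=.
rewrite -sqn_sum ?iota_uniq//; set P := \sum_(_ <- _) _.
have xP : dotR dot x P = sqn dot P.
  rewrite /P /sqn /dotR dot_sum_sum ?iota_uniq//; congr sre.
  by rewrite dot_sumr; apply: eq_bigr => i _; rewrite dotZr mulrC.
by have := sqn_ge0 dot (x - P); rewrite sqnB xP; lra.
Qed.

(** The orthogonal projection on the closed linear span of the family. *)
Definition span_proj x := expansion (fun i => dot x (e i)).

Lemma span_proj_cvg x : expansion_cvg (fun i => dot x (e i)).
Proof. exact/riesz_fischer/bessel_cvg. Qed.

Lemma residual_ortho x b :
  expansion_cvg b -> dot (x - span_proj x) (expansion b) = 0.
Proof.
move=> cb; have h := cvg_expansion_dotr (y := x - span_proj x) cb.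
rewrite -(cvg_lim _ h)//; apply/cvg_lim => //; apply: cvg_near_cst.
apply: nearW => n; rewrite /series /= dot_sumr big1// => i _.
by rewrite dotZr dotBl dot_expansion ?subrr ?mulr0//; exact: span_proj_cvg.
Qed.

(** The sum of [<x, e_i> <e_i, y>] is the inner product of the projection of [x]
    with [y], and the residual of [x] is orthogonal to the projection of [y]. *)
Lemma bessel_gap_proj x y :
  bessel_gap dot e x y = rnorm (dot (x - span_proj x) (y - span_proj y)).
Proof.
rewrite dotBr residual_ortho ?subr0; last exact: span_proj_cvg.
rewrite dotBl /bessel_gap; congr (rnorm (_ - _)).
have h := cvg_expansion_dotl (y := y) (@span_proj_cvg x).
apply/cvg_lim => //; apply: cvg_ext h => n; rewrite /series /=.
by rewrite dot_suml; apply: eq_bigr => i _; rewrite dotZl.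
Qed.

End orthonormal_series.

(** * The estimate for one vector *)

Section one_vector.
Context (R : realType) (k : scalar_kind).
Local Notation K := (scalar_field R k).
Context (H : completeNormedModType K) (dot : {dot H for @sconj R k}).
Hypothesis Hdot : hilbert_norm dot.
Context (e : nat -> H).
Hypothesis oe : orthonormal_family dot e.
Implicit Types (G g : nat -> K) (x y : H).
Local Notation proj := (span_proj dot e).

Lemma ell2_normB G g : ell2 G -> ell2 g ->
  ell2_norm (fun i => G i - g i) = rnorm (expansion e G - expansion e g).
Proof.
move=> /(riesz_fischer Hdot oe) cG /(riesz_fischer Hdot oe) cg.
have h := cvg_expansionB cG cg.
rewrite (ell2_norm_expansion Hdot oe); last first.
  by apply/cvg_ex; exists (expansion e G - expansion e g).
by congr rnorm; apply/cvg_lim.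
Qed.

Lemma ball_condition_re G g x : ell2 G -> ell2 g ->
  ball_condition e G g x <-> re_condition dot e G g x.
Proof.
move=> eG eg.
have cG := riesz_fischer Hdot oe eG; have cg := riesz_fischer Hdot oe eg.
have mid : limn [series ((G i + g i) / 2) *: e i]_i =
    2^-1 *: (expansion e G + expansion e g).
  by apply/cvg_lim => //; exact: cvg_expansion_mid.
rewrite /ball_condition /re_condition mid ell2_normB//.
rewrite -/(dotR dot _ _) -/(expansion e G) -/(expansion e g) polarization_ball.
rewrite subr_ge0 -(sqr_rnorm Hdot) -(rnorm_hnorm Hdot) ler_pXn2r//.
  by rewrite nnegrE rnorm_ge0.
by rewrite nnegrE mulr_ge0 ?rnorm_ge0.
Qed.

Lemma residual_norm_le G g x : ell2 G -> ell2 g -> 0 < sum_re G g ->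
  re_condition dot e G g x ->
  rnorm (x - proj x) <=
    2^-1 * (ell2_norm (fun i => G i - g i) / Num.sqrt (sum_re G g))
      * ell2_norm (fun i => dot x (e i)).
Proof.
move=> eG eg.
have cG := riesz_fischer Hdot oe eG; have cg := riesz_fischer Hdot oe eg.
have cx := @span_proj_cvg _ _ _ _ Hdot _ oe x.
rewrite ell2_normB// (sum_re_expansion Hdot oe cG cg).
rewrite (ell2_norm_expansion Hdot oe cx).
rewrite /re_condition -/(dotR dot _ _) -/(expansion e G) -/(expansion e g).
move=> S0 re.
rewrite !(rnorm_hnorm Hdot); apply: reverse_bessel => //.
  apply/eqP; rewrite -subr_eq0 /sqn -/(dotR dot _ _) -dotRNl -dotRDl.
  by rewrite /dotR (residual_ortho Hdot oe)// raddf0.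
apply/eqP; rewrite -subr_eq0 -dotRNl -dotRDl.
by rewrite /dotR dotDr !(residual_ortho Hdot oe)// addr0 raddf0.
Qed.

Lemma bessel_le x : ell2_norm (fun i => dot x (e i)) <= rnorm x.
Proof.
have cx := @span_proj_cvg _ _ _ _ Hdot _ oe x.
rewrite (ell2_norm_expansion Hdot oe cx).
rewrite -(ler_pXn2r (n := 2))// ?nnegrE ?rnorm_ge0// !(sqr_rnorm Hdot).
have /(congr1 (@sre R k)) := residual_ortho Hdot oe x cx.
rewrite raddf0 -/(dotR dot _ _) -/(proj x) dotRDl dotRNl => h.
have := sqn_ge0 dot (x - proj x).
by rewrite sqnB /sqn -/(dotR _ _ _) in h *; lra.
Qed.

End one_vector.

(** * The Hilbert space of square-summable sequences *)

Section square_summable.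
Context (R : realType) (k : scalar_kind).
Local Notation K := (scalar_field R k).

(** Completeness of the scalar field in the form used below: applied with [c]
    equal to 1 and to the conjugate of the imaginary unit, the hypothesis gives
    the limits of both real coordinates. *)
Lemma scalar_cvg_of_coords T (F : set_system T) {FF : Filter F} (f : T -> K) :
  (forall c : K, cvg ((fun t => sre (c * f t)) @ F)) -> cvg (f @ F).
Proof.
move=> cf.
have /cvg_ex[/= l cl] : cvg ((fun t => sre (f t)) @ F).
  by have := cf 1; under eq_fun do rewrite mul1r.
have /cvg_ex[/= m cm] := cf (sconj (imag_unit R k)).
apply/cvg_ex; exists (of_real k l + of_real k m * imag_unit R k).
rewrite (_ : f = fun t => of_real k (sre (f t)) +
    of_real k (sre (sconj (imag_unit R k) * f t)) * imag_unit R k); last first.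
  by apply/funext => t; exact: sre_decomp.
apply: cvgD; first exact: cvg_of_real.
by apply: cvgM; [exact: cvg_of_real | exact: cvg_cst].
Qed.

Lemma abs_series_cvg (z : nat -> K) :
  cvgn [series rnorm (z i)]_i -> cvgn [series z i]_i.
Proof.
move=> cz; apply: scalar_cvg_of_coords => c.
rewrite (_ : (fun n => _) = [series sre (c * z i)]_i); last first.
  by apply/funext => n; rewrite /series /= mulr_sumr raddf_sum.
apply: normed_cvg.
apply: (@series_le_cvg _ _ (rnorm c *: (fun i => rnorm (z i)))).
- by move=> n /=; exact: normr_ge0.
- by move=> n; rewrite /= mulr_ge0 ?rnorm_ge0.
- by move=> n /=; apply: le_trans (ler_sre _) _; rewrite rnormM.
- exact: is_cvg_seriesZ.
Qed.

Lemma ell2_mul_cvg (a b : nat -> K) :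
  ell2 a -> ell2 b -> cvgn [series a i * sconj (b i)]_i.
Proof.
move=> ca cb; apply: abs_series_cvg.
apply: (@series_le_cvg _ _
  ((fun i => rnorm (a i) ^+ 2) + (fun i => rnorm (b i) ^+ 2))).
- by move=> n; exact: rnorm_ge0.
- by move=> n; rewrite addr_ge0 ?sqr_ge0.
- move=> n; rewrite !fctE /= rnormM rnorm_conj.
  by have := rnorm_ge0 (a n); have := rnorm_ge0 (b n); nra.
- exact: is_cvg_seriesD.
Qed.

Definition ell2_pred : {pred nat -> K} := fun a => `[< ell2 a >].

Lemma ell2_predP a : reflect (ell2 a) (a \in ell2_pred).
Proof. exact: asboolP. Qed.

Lemma ell2_submod : submod_closed ell2_pred.
Proof.
split.
  apply/ell2_predP; rewrite /ell2 (_ : [series _]_ _ = cst 0).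
    exact: is_cvg_cst.
  apply/funext => n; rewrite /series /= big1// => i _.
  by rewrite rnorm0 expr0n.
move=> c a b /ell2_predP ca /ell2_predP cb; apply/ell2_predP.
(* |c a_n + b_n|^2 <= 2 |c|^2 |a_n|^2 + 2 |b_n|^2 *)
apply: (@series_le_cvg _ _ ((2 * rnorm c ^+ 2) *: (fun i => rnorm (a i) ^+ 2) +
  (2 : R) *: (fun i => rnorm (b i) ^+ 2))).
- by move=> n; exact: sqr_ge0.
- by move=> n; rewrite addr_ge0// mulr_ge0 ?sqr_ge0// mulr_ge0 ?sqr_ge0.
- move=> n; rewrite !fctE /GRing.scale /=.
  have := ler_rnormD (c * a n) (b n); rewrite rnormM => h.
  have := rnorm_ge0 (c * a n + b n).
  have := sqr_ge0 (rnorm c * rnorm (a n) - rnorm (b n)).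
  by nra.
- by apply: is_cvg_seriesD; exact: is_cvg_seriesZ.
Qed.

Lemma ell2_opp : oppr_closed ell2_pred.
Proof.
move=> a /ell2_predP ca; apply/ell2_predP; move: ca; rewrite /ell2.
by under [X in _ -> cvgn (series X)]eq_fun do rewrite fctE rnormN.
Qed.

HB.instance Definition _ := GRing.isOppClosed.Build _ ell2_pred ell2_opp.
HB.instance Definition _ :=
  GRing.isSubmodClosed.Build _ _ ell2_pred ell2_submod.

Record l2 := L2 {l2seq :> nat -> K; l2P : l2seq \in ell2_pred}.
HB.instance Definition _ := [isSub for l2seq].
HB.instance Definition _ := [Choice of l2 by <:].
HB.instance Definition _ := [SubChoice_isSubLmodule of l2 by <:].

Lemma ell2_l2 (a : l2) : ell2 a.
Proof. exact/ell2_predP/l2P. Qed.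
Arguments ell2_l2 : clear implicits.

Definition l2dot (a b : l2) : K := limn [series a i * sconj (b i)]_i.

Lemma cvg_l2dot (a b : l2) : [series a i * sconj (b i)]_i @ \oo --> l2dot a b.
Proof. by apply: ell2_mul_cvg; exact: ell2_l2. Qed.
Arguments cvg_l2dot : clear implicits.

Fact l2dot_addl b : zmod_morphism (l2dot ^~ b).
Proof.
move=> x y; apply/cvg_lim => //.
apply: cvg_ext (cvgB (cvg_l2dot x b) (cvg_l2dot y b)) => n.
rewrite !fctE /series /= -sumrB; apply: eq_bigr => i _.
by rewrite -mulrBl.
Qed.

Fact l2dot_conj x y : l2dot x y = sconj (l2dot y x).
Proof.
apply/cvg_lim => //; apply: cvg_ext (cvg_conj (cvg_l2dot y x)) => n.
rewrite /series /= rmorph_sum; apply: eq_bigr => i _.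
by rewrite rmorphM /= sconjK mulrC.
Qed.

Fact l2dot_scalel b : scalable_for *%R (l2dot ^~ b).
Proof.
move=> c x; apply/cvg_lim => //.
apply: cvg_ext (cvgM (cvg_cst c) (cvg_l2dot x b)) => n.
by rewrite /series /= mulr_sumr; apply: eq_bigr => i _; rewrite mulrA.
Qed.

Fact l2dot_addr a : zmod_morphism (l2dot a).
Proof. by move=> x y; rewrite !(l2dot_conj a) l2dot_addl rmorphB. Qed.

Fact l2dot_scaler a : scalable_for (@sconj R k \; *%R) (l2dot a).
Proof. by move=> c x; rewrite !(l2dot_conj a) l2dot_scalel rmorphM. Qed.

HB.instance Definition _ :=
  isBilinear.Build K l2 l2 K *%R (@sconj R k \; *%R) l2dot
    l2dot_addl l2dot_addr l2dot_scalel l2dot_scaler.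

Fact l2dot_herm x y : l2dot x y = (-1) ^+ false * sconj (l2dot y x).
Proof. by rewrite expr0 mul1r l2dot_conj. Qed.
HB.instance Definition _ :=
  isHermitianSesquilinear.Build K l2 false (@sconj R k) l2dot l2dot_herm.

Lemma l2dot_self a : l2dot a a = of_real k (limn [series rnorm (a i) ^+ 2]_i).
Proof.
apply/cvg_lim => //; apply: cvg_ext (cvg_of_real (k := k) (ell2_l2 a)) => n.
rewrite /series /= rmorph_sum; apply: eq_bigr => i _.
by rewrite mulr_sconj.
Qed.

Lemma l2_partial (a : l2) n :
  \sum_(0 <= i < n) rnorm (a i) ^+ 2 <= sre (l2dot a a).
Proof.
rewrite l2dot_self of_realK.
apply: (@nondecreasing_cvgn_le _ [series rnorm (a i) ^+ 2]_i).
  by apply: nondecreasing_series => i _ _; exact: sqr_ge0.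
exact: ell2_l2.
Qed.

Lemma l2_coord_le (a : l2) n : rnorm (a n) ^+ 2 <= sre (l2dot a a).
Proof.
apply: le_trans (l2_partial a n.+1); rewrite big_nat_recr//= lerDr.
by apply: sumr_ge0 => i _; exact: sqr_ge0.
Qed.

Lemma rnorm_eq0 (z : K) : rnorm z = 0 -> z = 0.
Proof. by move=> z0; apply/normr0_eq0; rewrite normr_rnorm z0 rmorph0. Qed.

Fact l2dot_gt0 a : a != 0 -> 0 < l2dot a a.
Proof.
move=> a0; have [n an] : exists n, a n != 0.
  apply: contra_notP (negP a0) => /forallNP h; apply/eqP/val_inj/funext => n.
  by apply/eqP/negPn/negP/h.
have := l2_coord_le a n; rewrite l2dot_self of_realK => h.
rewrite -(rmorph0 (of_real k)) ltr_of_real (lt_le_trans _ h)// exprn_gt0//.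
rewrite lt_neqAle rnorm_ge0 andbT eq_sym.
by apply: contra_neq an => /rnorm_eq0.
Qed.
HB.instance Definition _ := isDotProduct.Build K l2 l2dot l2dot_gt0.

Definition l2_dot : {dot l2 for @sconj R k} := l2dot.

Definition l2_norm (a : l2) : K := of_real k (hnorm l2_dot a).

Fact l2_normD a b : l2_norm (a + b) <= l2_norm a + l2_norm b.
Proof. by rewrite -rmorphD ler_of_real ler_hnormD. Qed.
Fact l2_normZ (c : K) a : l2_norm (c *: a) = `|c| * l2_norm a.
Proof. by rewrite /l2_norm hnormZ rmorphM normr_rnorm. Qed.
Fact l2_norm_eq0 a : l2_norm a = 0 -> a = 0.
Proof.
move=> /(congr1 (@sre R k)); rewrite of_realK raddf0; exact: hnorm_eq0.
Qed.

HB.instance Definition _ :=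
  Lmodule_isNormed.Build K l2 l2_normD l2_normZ l2_norm_eq0.

Lemma l2_rnorm (a : l2) : rnorm a = hnorm l2_dot a.
Proof. by rewrite /rnorm /Num.norm /= of_realK. Qed.

Lemma sqr_l2_rnorm (a : l2) : rnorm a ^+ 2 = sre (l2dot a a).
Proof. by rewrite l2_rnorm sqr_hnorm. Qed.

Lemma l2_coord_rnorm (a : l2) n : rnorm (a n) <= rnorm a.
Proof.
rewrite -(ler_pXn2r (n := 2))// ?nnegrE ?rnorm_ge0//.
by rewrite sqr_l2_rnorm l2_coord_le.
Qed.

Lemma l2_ball (a b : l2) (d : R) :
  ball a (of_real k d) b = (rnorm (a - b) < d) :> Prop.
Proof. by rewrite -ball_normE /= normr_rnorm ltr_of_real. Qed.

Lemma cauchy_l2_coord (F : set_system l2) (FF : ProperFilter F) n :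
  cauchy F -> cvg ((fun u : l2 => u n) @ F).
Proof.
move=> /cauchyP cF; apply: scalar_cvg_of_coords => c.
apply/cauchy_cvgP/cauchy_exP => d d0.
(* adding 1 avoids a division by zero when c = 0 *)
have c1 : 0 < rnorm c + 1 by rewrite ltr_wpDl ?rnorm_ge0.
have [u Fu] : exists u : l2, F (ball u (of_real k (d / (rnorm c + 1)))).
  by apply: cF; rewrite -(rmorph0 (of_real k)) ltr_of_real divr_gt0.
exists (sre (c * u n)); rewrite nbhs_filterE fmapE; apply: filterS Fu => v /=.
rewrite l2_ball -ball_normE /= -raddfB -mulrBr ltr_pdivlMr// => uv.
apply: le_lt_trans (ler_sre _) _; rewrite rnormM; apply: le_lt_trans uv.
rewrite mulrC; apply: ler_pM; rewrite ?rnorm_ge0 ?lerDl//.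
exact: (l2_coord_rnorm (u - v) n).
Qed.

(** Only finitely many coordinates occur in a partial sum, so a bound on it
    passes to the coordinatewise limit of [v]. *)
Lemma l2_lim_bound (F : set_system l2) (FF : ProperFilter F) (a : nat -> K)
    (u : l2) (d : R) :
  (forall n, (fun v : l2 => v n) @ F --> a n) ->
  0 <= d -> (\forall v \near F, rnorm (u - v) <= d) ->
  forall N, \sum_(0 <= i < N) rnorm (u i - a i) ^+ 2 <= d ^+ 2.
Proof.
move=> va d0 ud N.
have h : (fun v : l2 => \sum_(0 <= i < N) rnorm (u i - v i) ^+ 2) @ F -->
    \sum_(0 <= i < N) rnorm (u i - a i) ^+ 2.
  elim: N => [|N IH].
    by under eq_fun do rewrite big_nil; rewrite big_nil; exact: cvg_cst.
  under eq_fun do rewrite big_nat_recr//; rewrite big_nat_recr//=.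
  apply: cvgD => //; under eq_fun do rewrite expr2; rewrite expr2.
  have h : (fun v : l2 => rnorm (u N - v N)) @ F --> rnorm (u N - a N).
    apply: cvg_sre; apply: cvg_norm; apply: cvgB; last exact: va.
    exact: cvg_cst.
  exact: cvgM.
rewrite -(cvg_lim _ h)//; apply: limr_le.
  by apply/cvg_ex; eexists; exact: h.
apply: filterS ud => v uv; apply: le_trans (l2_partial (u - v) N) _.
by rewrite -sqr_l2_rnorm ler_pXn2r ?nnegrE ?rnorm_ge0.
Qed.

(** The limit of a Cauchy filter is the sequence [a] of the limits of the
    coordinates.  Elements [u] far in the filter are uniformly close to [a],
    by [l2_lim_bound], and [a] is square-summable as the difference of [u] and
    [u - a]. *)
Fact l2_complete (F : set_system l2) : ProperFilter F -> cauchy F -> cvg F.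
Proof.
move=> FF cF; pose a n : K := lim ((fun u : l2 => u n) @ F).
have va n : (fun v : l2 => v n) @ F --> a n by exact: cauchy_l2_coord.
have bd (d : R) : 0 < d -> \forall u \near F,
    forall N, \sum_(0 <= i < N) rnorm ((u : l2) i - a i) ^+ 2 <= d ^+ 2.
  move=> d0; move/cauchyP : cF => /(_ (of_real k (d / 2))) [].
    by rewrite -(rmorph0 (of_real k)) ltr_of_real divr_gt0.
  move=> w Fw; apply: filterS (Fw) => u; rewrite l2_ball => wu.
  apply: (@l2_lim_bound F FF a u d va (ltW d0)).
  apply: filterS Fw => v; rewrite l2_ball => wv.
  have -> : u - v = (w - v) - (w - u) by rewrite opprB [RHS]addrC subrKA.
  apply: le_trans (ler_rnormD _ _) _; rewrite rnormN; lra.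
have [u ub] := filter_ex (bd 1 ltr01).
have ea : a \in ell2_pred.
  rewrite -[a](subKr (u : nat -> K)); apply: rpredB; first exact: l2P.
  apply/ell2_predP; apply: nondecreasing_is_cvgn.
    by apply: nondecreasing_series => n _ _; exact: sqr_ge0.
  by exists (1 ^+ 2) => _ [n _ <-]; exact: ub.
apply/cvg_ex; exists (L2 ea); apply/fcvgrPdist_lt => d d0.
have d2 : 0 < sre d / 2 by rewrite divr_gt0// gt0_sre.
apply: filterS (bd _ d2) => v vb.
rewrite distrC normr_rnorm (ge0_of_real (ltW d0)) ltr_of_real.
apply: (@le_lt_trans _ _ (sre d / 2)); last by lra.
rewrite -(ler_pXn2r (n := 2))// ?nnegrE ?rnorm_ge0 ?(ltW d2)//.
rewrite sqr_l2_rnorm l2dot_self of_realK; apply: limr_le.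
  exact: ell2_l2.
by apply: nearW => n; exact: vb.
Qed.

HB.instance Definition _ := Uniform_isComplete.Build l2 l2_complete.

Definition l2_hilbert : completeNormedModType K := l2.

Lemma l2_hilbert_norm : @hilbert_norm R k l2_hilbert l2_dot.
Proof. by move=> a; exact: l2_rnorm. Qed.

Fact l2_delta_subproof (n : nat) : (fun i => (i == n)%:R : K) \in ell2_pred.
Proof.
apply/ell2_predP/cvg_ex; exists 1; apply: cvg_near_cst; near=> N.
rewrite /series /= (bigD1_seq n) ?iota_uniq//=; last first.
  by rewrite mem_index_iota leq0n /=; near: N; exact: nbhs_infty_gt.
rewrite eqxx -(rmorph1 (of_real k)) rnorm_of_real normr1 expr1n.
by rewrite big1 ?addr0// => i /negbTE ->; rewrite rnorm0 expr0n.
Unshelve. all: by end_near. Qed.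

Definition l2_delta n : l2_hilbert := L2 (l2_delta_subproof n).

Lemma l2_delta_orthonormal : orthonormal_family l2_dot l2_delta.
Proof.
have d m n : l2dot (l2_delta m) (l2_delta n) = (m == n)%:R.
  apply/cvg_lim => //; apply: cvg_near_cst; near=> N.
  rewrite /series /= (bigD1_seq m) ?iota_uniq//=; last first.
    by rewrite mem_index_iota leq0n /=; near: N; exact: nbhs_infty_gt.
  rewrite eqxx mul1r rmorph_nat big1 ?addr0// => i /negbTE ->.
  by rewrite mul0r.
split=> [m n /eqP/negbTE mn|n]; first by rewrite [LHS]d mn.
have /eqP := sqr_l2_rnorm (l2_delta n).
rewrite d eqxx -(rmorph1 (of_real k)) of_realK sqrp_eq1 ?rnorm_ge0//.
by move/eqP.
Unshelve. all: by end_near. Qed.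

End square_summable.

(** * Sharpness of the constant *)
(** If [n] vectors spanned [H], the [n.+1] rows of coordinates of
    [e 0, ..., e n] would be linearly dependent, so a nontrivial combination of
    the [e i] would vanish; but its inner product with [e i] is its coefficient
    at [i]. *)
Lemma orthonormal_infinite_dim (R : realType) (k : scalar_kind)
    (H : completeNormedModType (scalar_field R k))
    (dot : {dot H for @sconj R k}) (e : nat -> H) :
  hilbert_norm dot -> orthonormal_family dot e -> infinite_dim H.
Proof.
move=> Hdot oe [s span].
have /choice[c ec] i : exists c : nat -> scalar_field R k,
    e i = \sum_(0 <= j < size s) c j *: s`_j by exact: span.
pose M := \matrix_(i < (size s).+1, j < size s) c i j.
have kM : kermx M != 0.
  rewrite kermx_eq0 /row_free neq_ltn; apply/orP; left.
  by rewrite ltnS rank_leq_col.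
pose u := nz_row (kermx M).
have u0 : u != 0 by rewrite nz_row_eq0.
have uM : u *m M = 0 by apply/sub_kermxP; exact: nz_row_sub.
have ue : \sum_(i < (size s).+1) u 0 i *: e i = 0.
  under eq_bigr do rewrite ec big_mkord scaler_sumr.
  rewrite exchange_big big1//= => j _.
  under eq_bigr do rewrite scalerA.
  rewrite -scaler_suml; have /matrixP/(_ 0 j) := uM; rewrite !mxE => uMj.
  rewrite (_ : \sum_i _ = 0) ?scale0r// -[RHS]uMj.
  by apply: eq_bigr => i _; rewrite [M i j]mxE.
case/negP: u0; apply/eqP/rowP => i; rewrite mxE.
have := congr1 (dot ^~ (e i)) ue; rewrite /= dot0l dot_suml (bigD1 i)//= big1.
  by rewrite addr0 dotZl (dot_orthonormal Hdot oe) eqxx mulr1.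
move=> j ji; rewrite dotZl (dot_orthonormal Hdot oe).
by rewrite (_ : (_ == _ :> nat) = false) ?mulr0//; exact/negbTE.
Qed.

Section one_coefficient.
Context (R : realType) (k : scalar_kind).
Local Notation K := (scalar_field R k).

Definition single (r : R) : nat -> K :=
  fun i => of_real k (if i == 0%N then r else 0).

Lemma series_single (V : normedModType K) (r : R) (v : nat -> V) :
  [series single r i *: v i]_i @ \oo --> of_real k r *: v 0%N.
Proof.
apply: cvg_near_cst; near=> n.
have n0 : (0 < n)%N by near: n; exact: nbhs_infty_gt.
rewrite /series /= big_ltn// big_nat_cond big1 ?addr0//.
move=> i /andP[/andP[i0 _] _].
by rewrite /single gtn_eqF// rmorph0 scale0r.
Unshelve. all: by end_near. Qed.

Lemma ell2_single r : ell2 (single r).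
Proof.
apply/cvg_ex; exists (r ^+ 2); apply: cvg_near_cst; near=> n.
have n0 : (0 < n)%N by near: n; exact: nbhs_infty_gt.
rewrite /series /= big_ltn// /single rnorm_of_real real_normK ?num_real//.
rewrite big_nat_cond big1 ?addr0// => i /andP[/andP[i0 _] _].
by rewrite gtn_eqF// rmorph0 rnorm0 expr0n.
Unshelve. all: by end_near. Qed.

Lemma single_B r s : (fun i => single r i - single s i) = single (r - s).
Proof.
apply/funext => i; rewrite /single.
by case: ifP; rewrite ?rmorph0 ?subrr ?rmorphB.
Qed.

Context (H : completeNormedModType K) (dot : {dot H for @sconj R k}).
Hypothesis Hdot : hilbert_norm dot.
Context (e : nat -> H).
Hypothesis oe : orthonormal_family dot e.

Lemma expansion_single r : expansion e (single r) = of_real k r *: e 0%N.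
Proof. by apply/cvg_lim => //; exact: series_single. Qed.

Lemma expansion_cvg_single r : expansion_cvg e (single r).
Proof. by apply/cvg_ex; eexists; exact: series_single. Qed.
Arguments expansion_cvg_single : clear implicits.

Lemma dotR_scale r s (x y : H) :
  dotR dot (of_real k r *: x) (of_real k s *: y) = r * s * dotR dot x y.
Proof. by rewrite /dotR dotZl dotZr sconj_of_real !sre_of_realM mulrA. Qed.

Lemma sum_re_single r s : sum_re (single r) (single s) = r * s.
Proof.
have [cr cs] := (expansion_cvg_single r, expansion_cvg_single s).
rewrite (sum_re_expansion Hdot oe cr cs).
rewrite !expansion_single dotR_scale /dotR (dot_orthonormal Hdot oe) eqxx.
by rewrite -(rmorph1 (of_real k)) of_realK mulr1.
Qed.

Lemma ell2_norm_single r : ell2_norm (single r) = `|r|.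
Proof.
rewrite (ell2_norm_expansion Hdot oe (expansion_cvg_single r)) expansion_single.
rewrite /rnorm normrZ (normr_rnorm (of_real k r)) sre_of_realM rnorm_of_real.
by rewrite -/(rnorm (e 0%N)) (proj2 oe) mulr1.
Qed.

End one_coefficient.

(** In the plane of [e 0] and of a unit vector [f] orthogonal to the family, the
    disc with diameter from [e 0] to [4 e 0] has centre 5/2 and radius 3/2.  The
    line through the origin tangent to it has slope 3/4 and touches it at
    [x = (8/5, 6/5)], where the residual 6/5 is exactly
    [|G - g| / (2 sqrt S) = 3/4] times the projection 8/5. *)
Lemma quarter_attained (R : realType) (k : scalar_kind) :
  exists (H : completeNormedModType (scalar_field R k))
         (dot : {dot H for @sconj R k}) (e : nat -> H)
         (G g : nat -> scalar_field R k) (x : H),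
    [/\ hilbert_norm dot, infinite_dim H & orthonormal_family dot e] /\
    [/\ ell2 G, ell2 g & re_condition dot e G g x] /\
    [/\ sum_re G g = 4, ell2_norm (fun i => G i - g i) = 3,
        ell2_norm (fun i => dot x (e i)) = 8 / 5 &
        bessel_gap dot e x x = (6 / 5) ^+ 2].
Proof.
pose H := l2_hilbert R k; pose dot := @l2_dot R k : {dot H for @sconj R k}.
pose f := l2_delta R k 0; pose e n : H := l2_delta R k n.+1.
have Hdot : hilbert_norm dot by exact: l2_hilbert_norm.
have od : orthonormal_family dot (l2_delta R k) by exact: l2_delta_orthonormal.
have oe : orthonormal_family dot e.
  split=> [i j ij|i]; last exact: (proj2 od).
  by apply: (proj1 od) => -[].
have ff : dotR dot f f = 1.
  by rewrite /dotR (dot_orthonormal Hdot od) -(rmorph1 (of_real k)) of_realK.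
have ee : dotR dot (e 0%N) (e 0%N) = 1.
  by rewrite /dotR (dot_orthonormal Hdot od) -(rmorph1 (of_real k)) of_realK.
have ef : dotR dot (e 0%N) f = 0 by rewrite /dotR (proj1 od)// raddf0.
pose x : H := of_real k (8 / 5) *: e 0%N + of_real k (6 / 5) *: f.
have xe : (fun i => dot x (e i)) = single k (8 / 5).
  apply/funext => i; rewrite dotDl !dotZl !(dot_orthonormal Hdot od) /single.
  rewrite mulr0 addr0 eqSS eq_sym; case: eqP => _; first by rewrite mulr1.
  by rewrite mulr0 rmorph0.
exists H, dot, e, (single k 4), (single k 1), x; split.
  split=> //; exact: orthonormal_infinite_dim Hdot oe.
split; first split; [exact: ell2_single|exact: ell2_single| |].
  rewrite /re_condition -/(dotR _ _ _) -!/(expansion _ _) !expansion_single /x.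
  rewrite !dotRE !dotR_scale ee ff ef (dotRC _ f) ef.
  lra.
split.
- by rewrite (sum_re_single Hdot oe) mulr1.
- rewrite single_B (ell2_norm_single Hdot oe) ger0_norm; lra.
- by rewrite xe (ell2_norm_single Hdot oe) ger0_norm.
- rewrite (bessel_gap_proj Hdot oe) /span_proj xe expansion_single.
  rewrite /x addrC addKr.
  rewrite dot_self rnorm_of_real /sqn -/(dotR _ _ _) dotR_scale ff mulr1.
  by rewrite ger0_norm.
Qed.

(** * The inequalities for two vectors *)

Theorem theorem8 (R : realType) (k : scalar_kind) :
  (forall (H : completeNormedModType (scalar_field R k))
          (dot : {dot H for @sconj R k}) (e : nat -> H)
          (Gamma gamma phi Phi : nat -> scalar_field R k) (x y : H),
     hilbert_norm dot -> infinite_dim H -> orthonormal_family dot e ->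
     ell2 Gamma -> ell2 gamma -> ell2 phi -> ell2 Phi ->
     0 < sum_re Gamma gamma -> 0 < sum_re Phi phi ->
     ((ball_condition e Gamma gamma x /\ ball_condition e Phi phi y) <->
      (re_condition dot e Gamma gamma x /\ re_condition dot e Phi phi y)) /\
     ((ball_condition e Gamma gamma x /\ ball_condition e Phi phi y) \/
      (re_condition dot e Gamma gamma x /\ re_condition dot e Phi phi y) ->
      bessel_gap dot e x y
        <= 4^-1 * ((ell2_norm (fun i => Gamma i - gamma i)
                    * ell2_norm (fun i => Phi i - phi i))
                   / (Num.sqrt (sum_re Gamma gamma)
                      * Num.sqrt (sum_re Phi phi)))
           * ell2_norm (fun i => dot x (e i))
           * ell2_norm (fun i => dot y (e i))
      /\
      4^-1 * ((ell2_norm (fun i => Gamma i - gamma i)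
               * ell2_norm (fun i => Phi i - phi i))
              / (Num.sqrt (sum_re Gamma gamma)
                 * Num.sqrt (sum_re Phi phi)))
        * ell2_norm (fun i => dot x (e i))
        * ell2_norm (fun i => dot y (e i))
        <= 4^-1 * ((ell2_norm (fun i => Gamma i - gamma i)
                    * ell2_norm (fun i => Phi i - phi i))
                   / (Num.sqrt (sum_re Gamma gamma)
                      * Num.sqrt (sum_re Phi phi)))
           * rnorm x * rnorm y))
  /\
  (forall c : R,
     (forall (H : completeNormedModType (scalar_field R k))
             (dot : {dot H for @sconj R k}) (e : nat -> H)
             (Gamma gamma phi Phi : nat -> scalar_field R k) (x y : H),
        hilbert_norm dot -> infinite_dim H -> orthonormal_family dot e ->
        ell2 Gamma -> ell2 gamma -> ell2 phi -> ell2 Phi ->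
        0 < sum_re Gamma gamma -> 0 < sum_re Phi phi ->
        (ball_condition e Gamma gamma x /\ ball_condition e Phi phi y) \/
        (re_condition dot e Gamma gamma x /\ re_condition dot e Phi phi y) ->
        bessel_gap dot e x y
          <= c * ((ell2_norm (fun i => Gamma i - gamma i)
                   * ell2_norm (fun i => Phi i - phi i))
                  / (Num.sqrt (sum_re Gamma gamma)
                     * Num.sqrt (sum_re Phi phi)))
             * ell2_norm (fun i => dot x (e i))
             * ell2_norm (fun i => dot y (e i))) ->
     4^-1 <= c).
Proof.
split=> [H dot e G g phi Phi x y Hdot _ oe eG eg ephi ePhi SG SP|c hc].
  have balls : (ball_condition e G g x /\ ball_condition e Phi phi y) <->
      (re_condition dot e G g x /\ re_condition dot e Phi phi y).
    have bx := ball_condition_re Hdot oe x eG eg.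
    have by_ := ball_condition_re Hdot oe y ePhi ephi.
    by split=> -[/bx ? /by_ ?].
  split=> // hyp.
  have [rx ry] : re_condition dot e G g x /\ re_condition dot e Phi phi y.
    by case: hyp => [/balls|].
  have gx := residual_norm_le Hdot oe eG eg SG rx.
  have gy := residual_norm_le Hdot oe ePhi ephi SP ry.
  set A := ell2_norm (fun i => G i - g i) in gx *.
  set B := ell2_norm (fun i => Phi i - phi i) in gy *.
  set s := Num.sqrt (sum_re G g) in gx *.
  set t := Num.sqrt (sum_re Phi phi) in gy *.
  set a := ell2_norm (fun i => dot x (e i)) in gx *.
  set b := ell2_norm (fun i => dot y (e i)) in gy *.
  have s0 : 0 < s by rewrite sqrtr_gt0.
  have t0 : 0 < t by rewrite sqrtr_gt0.
  have ax : a <= rnorm x by exact: bessel_le.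
  have byy : b <= rnorm y by exact: bessel_le.
  split.
    rewrite (bessel_gap_proj Hdot oe).
    apply: le_trans (Cauchy_Schwarz _ _ _) _; rewrite -!(rnorm_hnorm Hdot).
    rewrite [leRHS](_ : _ = 2^-1 * (A / s) * a * (2^-1 * (B / t) * b)).
      by apply: ler_pM; rewrite ?rnorm_ge0.
    by field; rewrite !gt_eqF.
  have c0 : 0 <= 4^-1 * (A * B / (s * t)).
    by rewrite mulr_ge0// divr_ge0 ?mulr_ge0 ?sqrtr_ge0.
  rewrite -[leLHS]mulrA -[leRHS]mulrA; apply: ler_wpM2l => //.
  by apply: ler_pM; rewrite ?sqrtr_ge0.
have [H [dot [e [G [g [x]]]]]] := quarter_attained R k.
move=> [[Hdot infH oe] [[eG eg re] [S4 d3 x85 gap]]].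
have := hc H dot e G g g G x x Hdot infH oe eG eg eg eG.
have s44 : Num.sqrt 4 * Num.sqrt 4 = 4 :> R by rewrite -expr2 sqr_sqrtr.
rewrite S4 d3 x85 gap s44 => /(_ (ltr0n _ 4) (ltr0n _ 4)).
by move=> /(_ (or_intror (conj re re))); lra.
Qed.
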